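(* If $\mathrm K\nu$ is totally separated for every code $\nu:\mathrm E$, then $\neg\neg\mathrm{WLPO}$ holds.
   Context: Foundation: intensional Martin-Löf type theory as in the HoTT Book, with $\mathbf 0$, $\mathbf 1$ (point $\star$), $\mathbf 2$ (points $0,1$), $\mathbb N$, $+$, $\Pi$, $\Sigma$, universes, univalence (hence function extensionality), propositional truncation, set quotients, and inductive-recursive definitions. No excluded middle is assumed. $f^{-1}(y):=\Sigma_x(f\,x=y)$; an embedding is a map all of whose fibers are propositions (types with at most one element). $X$ is decidable if $X+\neg X$. $X$ is totally separated if for all $x,y:X$, $(\prod_{p:X\to\mathbf 2}p\,x=p\,y)\to x=y$; an ordinal is totally separated if its underlying type is. $\mathrm{WLPO}$ says that for every $p:\mathbb N\to\mathbf 2$ the type $\prod_n\,p\,n=1$ is decidable. Ordinals. An ordinal is a type with a proposition-valued, transitive, extensional (elements with the same predecessors are equal), well-founded relation $<$; the same symbol denotes an ordinal and its underlying type. $\mathbf 1$ is an ordinal with the empty order. A topped ordinal is an ordinal with a specified point $t$ such that $\neg(t<y)$ for all $y$; $\mathrm{Ord}^\top$ is their type. For a topped ordinal $\tau$ and $\upsilon:\tau\to\mathrm{Ord}^\top$, $\Sigma_\tau\upsilon$ is the topped ordinal $\Sigma_{x:\tau}\upsilon\,x$ with the lexicographic order: $(x,a)<(x',a')$ iff $x<x'$, or there is $r:x=x'$ such that the transport of $a$ along $r$ is below $a'$; its top is the pair of tops. The sum $\tau+\upsilon$ of topped ordinals is the lexicographic sum, over the two-point topped ordinal with underlying type $\mathbf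 1+\mathbf 1$ and $\mathrm{inl}\,\star<\mathrm{inr}\,\star$, of the family with members $\tau,\upsilon$; its points are pairs $(\mathrm{inl}\,\star,x)$ or $(\mathrm{inr}\,\star,y)$. The topped ordinal $\omega+\mathbf 1$ is $\mathbb N+\mathbf 1$ with the usual order on $\mathbb N$ and the added point as top, above all $\mathrm{inl}\,n$. Conaturals: $\mathbb N_\infty:=\Sigma_{u:\mathbf 2^{\mathbb N}}\prod_i u_{i+1}\le u_i$; $\underline n$ is $n$ ones followed by zeros; $\infty$ is constantly $1$. It is a topped ordinal with top $\infty$ under $u<v:\equiv\Sigma_{n:\mathbb N}(u=\underline n)\times(v_n=1)$. $\iota_1:\mathbb N+\mathbf 1\hookrightarrow\mathbb N_\infty$ sends $\mathrm{inl}\,n$ to $\underline n$ and the added point to $\infty$. Extension: for an embedding $j:X\hookrightarrow K$ and $\alpha:X\to\mathrm{Ord}^\top$, $(\alpha/j)\,k:=\prod_{(x,p):j^{-1}(k)}\alpha\,x$ with order $u<v:\equiv\Sigma_{p:j^{-1}(k)}\,u\,p<v\,p$ and top the function assigning tops. Evaluation at $(x,\mathrm{refl})$ is an order equivalence $(\alpha/j)(j\,x)\simeq\alpha\,x$. Codes. $\mathrm E$ and $\Delta:\mathrm E\to\mathrm{Ord}^\top$ are defined simultaneously by induction-recursion. Constructors of $\mathrm E$: $\ulcorner\mathbf 1\urcorner$; $\ulcorner\omega+\mathbf 1\urcorner$; $\nu_0\,\ulcorner+\urcorner\,\nu_1$ and $\nu_0\,\ulcorner\times\urcorner\,\nu_1$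 for $\nu_0,\nu_1:\mathrm E$; $\ulcorner\Sigma\urcorner\,\nu\,A$ for $\nu:\mathrm E$ and $A:\Delta\nu\to\mathrm E$. $\Delta\ulcorner\mathbf 1\urcorner=\mathbf 1$; $\Delta\ulcorner\omega+\mathbf 1\urcorner=\omega+\mathbf 1$; $\Delta(\nu_0\,\ulcorner+\urcorner\,\nu_1)=\Delta\nu_0+\Delta\nu_1$; $\Delta(\nu_0\,\ulcorner\times\urcorner\,\nu_1)=\Sigma_{\Delta\nu_0}(\lambda\_.\,\Delta\nu_1)$; $\Delta(\ulcorner\Sigma\urcorner\,\nu\,A)=\Sigma_{\Delta\nu}(\Delta\circ A)$. Simultaneously by induction on codes one defines $\mathrm K:\mathrm E\to\mathrm{Ord}^\top$ and $\iota_\nu:\Delta\nu\to\mathrm K\nu$ and proves that $\iota_\nu$ is an embedding: $\mathrm K\ulcorner\mathbf 1\urcorner=\mathbf 1$; $\mathrm K\ulcorner\omega+\mathbf 1\urcorner=\mathbb N_\infty$; $\mathrm K(\nu_0\,\ulcorner+\urcorner\,\nu_1)=\mathrm K\nu_0+\mathrm K\nu_1$; $\mathrm K(\nu_0\,\ulcorner\times\urcorner\,\nu_1)=\Sigma_{\mathrm K\nu_0}(\lambda\_.\,\mathrm K\nu_1)$; $\mathrm K(\ulcorner\Sigma\urcorner\,\nu\,A)=\Sigma_{\mathrm K\nu}\big((\mathrm K\circ A)/\iota_\nu\big)$; and $\iota_{\ulcorner\mathbf 1\urcorner}=\mathrm{id}$; $\iota_{\ulcorner\omega+\mathbf 1\urcorner}=\iota_1$;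 $\iota_{\nu_0\ulcorner+\urcorner\nu_1}(\mathrm{inl}\,\star,y)=(\mathrm{inl}\,\star,\iota_{\nu_0}y)$, $\iota_{\nu_0\ulcorner+\urcorner\nu_1}(\mathrm{inr}\,\star,y)=(\mathrm{inr}\,\star,\iota_{\nu_1}y)$; $\iota_{\nu_0\ulcorner\times\urcorner\nu_1}(x,y)=(\iota_{\nu_0}x,\iota_{\nu_1}y)$; $\iota_{\ulcorner\Sigma\urcorner\nu A}(x,z)=(\iota_\nu x,\varphi_x^{-1}(\iota_{A\,x}z))$, where $\varphi_x:((\mathrm K\circ A)/\iota_\nu)(\iota_\nu x)\simeq\mathrm K(A\,x)$ is evaluation at $(x,\mathrm{refl})$. *)

(* Defs.v *)
From Stdlib Require Import Arith Bool Eqdep_dec.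
From Stdlib Require Import FunctionalExtensionality HLevels.

Set Implicit Arguments.
Unset Strict Implicit.
Set Primitive Projections.

(* The identity type is [eq].  No axiom is used except function
   extensionality; in particular propositions are the types satisfying
   [IsHProp], and proof irrelevance is not assumed.  Order relations are
   [Type]-valued so that their witnesses are available. *)

Definition neg (X : Type) : Type := X -> False.

Definition decidable (X : Type) : Type := (X + neg X)%type.

Definition WLPO : Type :=
  forall p : nat -> bool, decidable (forall n, p n = true).

Definition transport {X : Type} (P : X -> Type) {x y : X} (r : x = y) (a : P x)
  : P y := eq_rect x P a y r.
Arguments transport {X} P {x y} r a.

Definition fiber {X Y : Type} (f : X -> Y) (y : Y) : Type := {x : X & f x = y}.

Definition is_embedding {X Y : Type} (f : X -> Y) : Type :=
  forall y : Y, IsHProp (fiber f y).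

Definition totally_separated (X : Type) : Type :=
  forall x y : X, (forall p : X -> bool, p x = p y) -> x = y.

(* [Acc] of the standard library takes [Prop]-valued relations only. *)
Inductive accessible {X : Type} (R : X -> X -> Type) (x : X) : Type :=
  acc : (forall y, R y x -> accessible R y) -> accessible R x.

Record is_ordinal {X : Type} (R : X -> X -> Type) : Type := {
  ord_prop : forall x y, IsHProp (R x y);
  ord_trans : forall x y z, R x y -> R y z -> R x z;
  ord_ext : forall x y,
    (forall z, R z x -> R z y) -> (forall z, R z y -> R z x) -> x = y;
  ord_wf : forall x, accessible R x }.

Record Ordinal : Type := {
  carrier :> Type;
  olt : carrier -> carrier -> Type;
  olt_ordinal : is_ordinal olt }.

Notation "x ≺ y" := (olt x y) (at level 70, no associativity).

Record TOrd : Type := {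
  underlying :> Ordinal;
  top : underlying;
  top_max : forall y : underlying, neg (top ≺ y) }.

Definition ord_totally_separated (a : Ordinal) : Type := totally_separated a.

Lemma collapsible_hset (X : Type)
  (c : forall x y : X, x = y -> x = y)
  (cc : forall x y (p q : x = y), c x y p = c x y q) : IsHSet X.
Proof.
  assert (H : forall x y (p : x = y),
             p = eq_trans (eq_sym (c x x eq_refl)) (c x y p)).
  { intros x y p. destruct p. destruct (c x x eq_refl). reflexivity. }
  intros x y p q. rewrite (H _ _ p), (H _ _ q), (cc x y p q). reflexivity.
Qed.

Lemma pi_hprop (A : Type) (P : A -> Type) :
  (forall x, IsHProp (P x)) -> IsHProp (forall x, P x).
Proof. intros H f g. apply functional_extensionality_dep. intro x. apply H. Qed.

Lemma ordinal_hset (X : Type) (R : X -> X -> Type) : is_ordinal R -> IsHSet X.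
Proof.
  intros O.
  apply (@collapsible_hset X (fun x y e =>
    ord_ext O (fun z => transport (fun w => R z w) e)
              (fun z => transport (fun w => R z w) (eq_sym e)))).
  intros x y p q. f_equal; (apply pi_hprop; intro z; apply pi_hprop; intro);
    apply (ord_prop O).
Qed.

Lemma carrier_hset (a : Ordinal) : IsHSet a.
Proof. exact (ordinal_hset (olt_ordinal a)). Qed.

Lemma accessible_irrefl (X : Type) (R : X -> X -> Type) (x : X) :
  accessible R x -> neg (R x x).
Proof. intros a. induction a as [x _ IH]. intros r. exact (IH x r r). Qed.

Lemma ord_irrefl (a : Ordinal) (x : a) : neg (x ≺ x).
Proof. exact (accessible_irrefl (ord_wf (olt_ordinal a) x)). Qed.

Lemma injective_embedding (X Y : Type) (f : X -> Y) (hY : IsHSet Y) :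
  (forall x x', f x = f x' -> x = x') -> is_embedding f.
Proof.
  intros inj y [x p] [x' p'].
  assert (e : x = x') by (apply inj; rewrite p, p'; reflexivity).
  destruct e. f_equal. apply hY.
Qed.

Lemma embedding_injective (X Y : Type) (f : X -> Y) :
  is_embedding f -> forall x x', f x = f x' -> x = x'.
Proof.
  intros h x x' e.
  exact (f_equal (@projT1 _ _) (h (f x') (existT _ x e) (existT _ x' eq_refl))).
Qed.

Lemma existT_inj2 (X : Type) (P : X -> Type) (hX : IsHSet X) (x : X) (a b : P x) :
  existT P x a = existT P x b -> a = b.
Proof.
  intros e.
  assert (H : forall (u v : {x : X & P x}) (e : u = v),
             {r : projT1 u = projT1 v & transport P r (projT2 u) = projT2 v}).
  { intros u v []. exists eq_refl. reflexivity. }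
  destruct (H _ _ e) as [r s]. cbn in r, s.
  rewrite (hX _ _ r eq_refl) in s. exact s.
Qed.

Lemma one_ordinal : is_ordinal (fun _ _ : unit => False).
Proof.
  split.
  - intros _ _. exact false_hprop.
  - intros; assumption.
  - intros [] []; reflexivity.
  - intros x. constructor. intros y [].
Qed.

Definition oneT : TOrd := {|
  underlying := {| carrier := unit; olt_ordinal := one_ordinal |};
  top := tt : {| carrier := unit; olt_ordinal := one_ordinal |};
  top_max := fun _ r => r |}.

Definition two_lt (x y : unit + unit) : Type :=
  match x, y with inl _, inr _ => unit | _, _ => False end.

Lemma two_ordinal : is_ordinal two_lt.
Proof.
  split.
  - intros [x|x] [y|y]; try exact false_hprop. intros [] []; reflexivity.
  - intros [x|x] [y|y] [z|z]; cbn; tauto.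
  - intros [[]|[]] [[]|[]] h k; try reflexivity.
    + destruct (k (inl tt) tt).
    + destruct (h (inl tt) tt).
  - assert (h : forall u, accessible two_lt (inl u)).
    { intros u. constructor. intros [y|y] []. }
    intros [x|x]; [apply h|]. constructor. intros [y|y] r; [apply h|destruct r].
Qed.

Lemma two_top (y : unit + unit) : neg (two_lt (inr tt) y).
Proof. destruct y; intros []. Qed.

Definition twoT : TOrd := {|
  underlying := {| carrier := unit + unit; olt_ordinal := two_ordinal |};
  top := inr tt : {| carrier := unit + unit; olt_ordinal := two_ordinal |};
  top_max := two_top |}.

Definition omega1_lt (x y : nat + unit) : Type :=
  match x, y with
  | inl m, inl n => (m < n)%nat
  | inl _, inr _ => unit
  | inr _, _ => False
  end.

Lemma omega1_ordinal : is_ordinal omega1_lt.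
Proof.
  split.
  - intros [m|[]] [n|[]]; cbn; try exact false_hprop.
    + intros p q. apply Peano_dec.le_unique.
    + intros [] []; reflexivity.
  - intros [l|[]] [m|[]] [n|[]]; cbn; try tauto. apply Nat.lt_trans.
  - intros [m|[]] [n|[]] h k; try reflexivity.
    + destruct (lt_eq_lt_dec m n) as [[l|e]|l].
      * destruct (Nat.lt_irrefl m (k (inl m) l)).
      * rewrite e; reflexivity.
      * destruct (Nat.lt_irrefl n (h (inl n) l)).
    + destruct (Nat.lt_irrefl m (k (inl m) tt)).
    + destruct (Nat.lt_irrefl n (h (inl n) tt)).
  - assert (h : forall n m, (m < n)%nat -> accessible omega1_lt (inl m)).
    { induction n as [|n IH]; intros m l.
      - destruct (Nat.nlt_0_r m l).
      - constructor. intros [k|[]] r; [|destruct r].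
        apply IH. cbn in r.
        exact (Nat.lt_le_trans _ _ _ r (proj1 (Nat.lt_succ_r m n) l)). }
    intros [m|[]].
    + exact (h (S m) m (Nat.lt_succ_diag_r m)).
    + constructor. intros [m|[]] r; [|destruct r].
      exact (h (S m) m (Nat.lt_succ_diag_r m)).
Qed.

Definition omega1T : TOrd := {|
  underlying := {| carrier := nat + unit; olt_ordinal := omega1_ordinal |};
  top := inr tt : {| carrier := nat + unit; olt_ordinal := omega1_ordinal |};
  top_max := fun _ r => r |}.

Definition conat : Type :=
  {u : nat -> bool & forall i, Bool.le (u (S i)) (u i)}.

Definition conat_at (u : conat) : nat -> bool := projT1 u.

Lemma ltb_decreasing (n i : nat) : Bool.le (Nat.ltb (S i) n) (Nat.ltb i n).
Proof.
  unfold Bool.le. destruct (Nat.ltb_spec (S i) n) as [l|l]; [|exact I].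
  apply Nat.ltb_lt. exact (Nat.lt_trans _ _ _ (Nat.lt_succ_diag_r i) l).
Qed.

Definition finite_conat (n : nat) : conat :=
  existT (fun u => forall i, Bool.le (u (S i)) (u i))
    (fun i => Nat.ltb i n) (ltb_decreasing n).

Definition infty : conat :=
  existT (fun u => forall i, Bool.le (u (S i)) (u i))
    (fun _ => true) (fun _ => eq_refl).

Definition conat_lt (u v : conat) : Type :=
  {n : nat & ((u = finite_conat n) * (conat_at v n = true))%type}.

Lemma bool_hset : IsHSet bool.
Proof. intros x y p q. apply UIP_dec. exact Bool.bool_dec. Qed.

Lemma conat_ext (u v : conat) : (forall n, conat_at u n = conat_at v n) -> u = v.
Proof.
  destruct u as [u hu], v as [v hv]; cbn. intros e.
  apply functional_extensionality in e. destruct e. f_equal.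
  apply pi_hprop. intros i. unfold Bool.le. destruct (u (S i)).
  - intros p q. apply bool_hset.
  - exact true_hprop.
Qed.

Lemma conat_hset : IsHSet conat.
Proof.
  apply (@collapsible_hset conat (fun u v e =>
    @conat_ext u v (fun n => f_equal (fun w => conat_at w n) e))).
  intros u v p q. f_equal. apply pi_hprop. intros n a b. apply bool_hset.
Qed.

Lemma conat_eq_true (u v : conat) :
  (forall n, conat_at u n = true -> conat_at v n = true) ->
  (forall n, conat_at v n = true -> conat_at u n = true) -> u = v.
Proof.
  intros h k. apply conat_ext. intros n. specialize (h n). specialize (k n).
  destruct (conat_at u n), (conat_at v n); try reflexivity.
  - symmetry; exact (h eq_refl).
  - exact (k eq_refl).
Qed.

Lemma conat_decr (v : conat) (m n : nat) :
  (n <= m)%nat -> conat_at v m = true -> conat_at v n = true.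
Proof.
  intros l. induction l as [|m l IH]; [trivial|].
  intros e. apply IH. pose proof (projT2 v m) as d. fold (conat_at v) in d.
  unfold Bool.le in d. rewrite e in d. exact d.
Qed.

Lemma finite_conat_inj (m n : nat) : finite_conat m = finite_conat n -> m = n.
Proof.
  intros e.
  assert (h : forall i, Nat.ltb i m = Nat.ltb i n).
  { intros i. exact (f_equal (fun w => conat_at w i) e). }
  destruct (lt_eq_lt_dec m n) as [[l|l]|l]; [|exact l|].
  - apply Nat.ltb_lt in l. rewrite <- h, Nat.ltb_irrefl in l. discriminate.
  - apply Nat.ltb_lt in l. rewrite h, Nat.ltb_irrefl in l. discriminate.
Qed.

Lemma finite_conat_infty (n : nat) : finite_conat n = infty -> False.
Proof.
  intros e. pose proof (f_equal (fun w => conat_at w n) e) as h.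
  change (Nat.ltb n n = true) in h. rewrite Nat.ltb_irrefl in h. discriminate.
Qed.

Lemma conat_ordinal : is_ordinal conat_lt.
Proof.
  split.
  - intros u v [m [p a]] [n [q b]].
    assert (e : m = n) by (apply finite_conat_inj; rewrite <- p; exact q).
    destruct e. rewrite (conat_hset p q), (bool_hset a b). reflexivity.
  - intros u v w [m [p a]] [n [q b]]. exists m. split; [exact p|].
    apply (@conat_decr w n m); [|exact b].
    rewrite q in a. change (Nat.ltb m n = true) in a. apply Nat.lt_le_incl, Nat.ltb_lt, a.
  - intros u v h k. apply conat_eq_true.
    + intros n a. destruct (h (finite_conat n)) as [m [p b]].
      * exists n. split; [reflexivity|exact a].
      * rewrite (finite_conat_inj p). exact b.
    + intros n a. destruct (k (finite_conat n)) as [m [p b]].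
      * exists n. split; [reflexivity|exact a].
      * rewrite (finite_conat_inj p). exact b.
  - assert (h : forall n m, (m < n)%nat -> accessible conat_lt (finite_conat m)).
    { induction n as [|n IH]; intros m l.
      - destruct (Nat.nlt_0_r m l).
      - constructor. intros y [k [p a]]. rewrite p. apply IH.
        change (Nat.ltb k m = true) in a. apply Nat.ltb_lt in a.
        exact (Nat.lt_le_trans _ _ _ a (proj1 (Nat.lt_succ_r m n) l)). }
    intros u. constructor. intros v [n [p _]]. rewrite p.
    exact (h (S n) n (Nat.lt_succ_diag_r n)).
Qed.

Lemma conat_top (v : conat) : neg (conat_lt infty v).
Proof. intros [n [p _]]. exact (finite_conat_infty (eq_sym p)). Qed.

Definition conatT : TOrd := {|
  underlying := {| carrier := conat; olt_ordinal := conat_ordinal |};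
  top := infty : {| carrier := conat; olt_ordinal := conat_ordinal |};
  top_max := conat_top |}.

Definition iota1 (x : nat + unit) : conat :=
  match x with inl n => finite_conat n | inr _ => infty end.

Lemma iota1_embedding : is_embedding iota1.
Proof.
  apply (injective_embedding conat_hset). intros [m|[]] [n|[]] e; cbn in e.
  - rewrite (finite_conat_inj e). reflexivity.
  - destruct (finite_conat_infty e).
  - destruct (finite_conat_infty (eq_sym e)).
  - reflexivity.
Qed.

Section Sums.
Variables (t : TOrd) (u : t -> TOrd).

Definition lex_lt (p q : {x : t & u x}) : Type :=
  ((projT1 p ≺ projT1 q) +
   {r : projT1 p = projT1 q &
     transport (fun x => u x) r (projT2 p) ≺ projT2 q})%type.

Lemma lex_ordinal : is_ordinal lex_lt.
Proof.
  split.
  - intros [x a] [y b] [r|[e r]] [s|[f s]]; cbn in *.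
    + f_equal. apply (ord_prop (olt_ordinal t)).
    + destruct f. destruct (ord_irrefl r).
    + destruct e. destruct (ord_irrefl s).
    + f_equal. destruct (carrier_hset e f). f_equal.
      apply (ord_prop (olt_ordinal (u y))).
  - intros [x a] [y b] [z c] [r|[e r]] [s|[f s]]; cbn in *.
    + left. exact (ord_trans (olt_ordinal t) r s).
    + left. cbn. destruct f. exact r.
    + left. cbn. destruct e. exact s.
    + right. cbn. destruct e, f. exists eq_refl.
      exact (ord_trans (olt_ordinal (u x)) r s).
  - assert (base : forall x y (a : u x) (b : u y),
      (forall z, lex_lt z (existT _ x a) -> lex_lt z (existT _ y b)) ->
      forall z : t, z ≺ x -> z ≺ y).
    { intros x y a b h z r.
      destruct (h (existT _ z (top (u z))) (inl r)) as [s|[e s]]; [exact s|].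
      cbn in e, s. destruct e. destruct (top_max s). }
    assert (over : forall x (a b : u x),
      (forall z, lex_lt z (existT _ x a) -> lex_lt z (existT _ x b)) ->
      forall c : u x, c ≺ a -> c ≺ b).
    { intros x a b h c r.
      destruct (h (existT _ x c) (inr (existT _ eq_refl r))) as [s|[e s]];
        cbn in *.
      - destruct (ord_irrefl s).
      - rewrite (carrier_hset e eq_refl) in s. exact s. }
    intros [x a] [y b] h k.
    assert (e : x = y).
    { apply (ord_ext (olt_ordinal t)).
      - exact (base _ _ _ _ h).
      - exact (base _ _ _ _ k). }
    destruct e. f_equal. apply (ord_ext (olt_ordinal (u x))).
    + exact (over _ _ _ h).
    + exact (over _ _ _ k).
  - assert (h : forall x : t, accessible (@olt t) x ->
                forall a : u x, accessible lex_lt (existT _ x a)).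
    { intros x ax. induction ax as [x _ IH]. intros a.
      induction (ord_wf (olt_ordinal (u x)) a) as [a _ IHa].
      constructor. intros [y b] [r|[e r]]; cbn in *.
      - exact (IH y r b).
      - destruct e. exact (IHa b r). }
    intros [x a]. apply h. exact (ord_wf (olt_ordinal t) x).
Qed.

Definition sigma_top : {x : t & u x} := existT (fun x => u x) (top t) (top (u (top t))).

Lemma lex_top (q : {x : t & u x}) : neg (lex_lt sigma_top q).
Proof.
  destruct q as [y b]. intros [r|[e r]]; cbn in *.
  - exact (top_max r).
  - destruct e. exact (top_max r).
Qed.

Definition sigmaT : TOrd := {|
  underlying := {| carrier := {x : t & u x}; olt_ordinal := lex_ordinal |};
  top := sigma_top : {| carrier := {x : t & u x}; olt_ordinal := lex_ordinal |};
  top_max := lex_top |}.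

End Sums.

Definition pair_family (t u : TOrd) (b : twoT) : TOrd :=
  match b with inl _ => t | inr _ => u end.

Definition plusT (t u : TOrd) : TOrd := sigmaT (pair_family t u).

Definition timesT (t u : TOrd) : TOrd := sigmaT (fun _ : t => u).

Section Extension.
Variables (X Y : Type) (j : X -> Y) (hj : is_embedding j) (a : X -> TOrd).

Definition ext_carrier (k : Y) : Type := forall p : fiber j k, a (projT1 p).

Definition ext_lt (k : Y) (u v : ext_carrier k) : Type :=
  {p : fiber j k & u p ≺ v p}.

Lemma ext_ordinal (k : Y) : is_ordinal (@ext_lt k).
Proof.
  split.
  - intros u v [p r] [q s]. destruct (hj p q). f_equal.
    apply (ord_prop (olt_ordinal (a (projT1 p)))).
  - intros u v w [p r] [q s]. destruct (hj p q). exists p.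
    exact (ord_trans (olt_ordinal (a (projT1 p))) r s).
  - assert (h : forall u v : ext_carrier k,
      (forall z, ext_lt z u -> ext_lt z v) ->
      forall p (c : a (projT1 p)), c ≺ u p -> c ≺ v p).
    { intros u v H p c r.
      pose (w := fun q : fiber j k =>
                   transport (fun q => carrier (a (projT1 q))) (hj p q) c).
      assert (ew : w p = c).
      { unfold w. rewrite (hset_hprop _ (hj (y:=k)) _ _ (hj p p) eq_refl).
        reflexivity. }
      destruct (H w) as [q s].
      - exists p. rewrite ew. exact r.
      - destruct (hj p q). rewrite ew in s. exact s. }
    intros u v H G. apply functional_extensionality_dep. intros p.
    apply (ord_ext (olt_ordinal (a (projT1 p)))).
    + exact (h _ _ H p).
    + exact (h _ _ G p).
  - assert (h : forall (p : fiber j k) (c : a (projT1 p)),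
      accessible (@olt (a (projT1 p))) c ->
      forall u : ext_carrier k, u p = c -> accessible (@ext_lt k) u).
    { intros p c ac. induction ac as [c _ IH]. intros u e.
      constructor. intros v [q r]. destruct (hj p q).
      apply (IH (v p)); [|reflexivity]. rewrite <- e. exact r. }
    intros u. constructor. intros v [p _].
    exact (h p (v p) (ord_wf (olt_ordinal (a (projT1 p))) (v p)) v eq_refl).
Qed.

Definition ext_top (k : Y) : ext_carrier k := fun p => top (a (projT1 p)).

Lemma ext_top_max (k : Y) (v : ext_carrier k) : neg (ext_lt (ext_top (k:=k)) v).
Proof. intros [p r]. exact (top_max r). Qed.

Definition extT (k : Y) : TOrd := {|
  underlying := {| carrier := ext_carrier k; olt_ordinal := ext_ordinal k |};
  top := ext_top (k:=k) : {| carrier := ext_carrier k; olt_ordinal := ext_ordinal k |};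
  top_max := @ext_top_max k |}.

Definition ext_eval (x : X) (u : extT (j x)) : a x := u (existT _ x eq_refl).

Definition ext_eval_inv (x : X) (c : a x) : extT (j x) :=
  fun p : fiber j (j x) =>
    transport (fun q => carrier (a (projT1 q))) (hj (existT _ x eq_refl) p) c.

Lemma ext_eval_section (x : X) (c : a x) : ext_eval (ext_eval_inv c) = c.
Proof.
  unfold ext_eval, ext_eval_inv.
  rewrite (hset_hprop _ (hj (y:=j x)) _ _ (hj (existT _ x eq_refl) _) eq_refl).
  reflexivity.
Qed.

Lemma ext_eval_retraction (x : X) (u : extT (j x)) : ext_eval_inv (ext_eval u) = u.
Proof.
  apply functional_extensionality_dep. intros p. unfold ext_eval_inv, ext_eval.
  destruct (hj (existT _ x eq_refl) p). reflexivity.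
Qed.

Lemma ext_eval_lt (x : X) (u v : extT (j x)) : u ≺ v -> ext_eval u ≺ ext_eval v.
Proof.
  intros [p r].
  assert (h : forall q, u q ≺ v q) by (intros q; destruct (hj p q); exact r).
  exact (h (existT _ x eq_refl)).
Qed.

Lemma ext_eval_inv_lt (x : X) (c d : a x) :
  c ≺ d -> ext_eval_inv c ≺ ext_eval_inv d.
Proof.
  intros r. exists (existT (fun y => j y = j x) x eq_refl).
  pose proof (ext_eval_section c) as ec. pose proof (ext_eval_section d) as ed.
  unfold ext_eval in ec, ed. rewrite ec, ed. exact r.
Qed.

End Extension.

(* The inductive-recursive pair (E, Delta) is encoded by the inductive
   family of codes indexed by the value of Delta: [code t] is the fiber of
   Delta over [t], and E is the total type of this family.  The cost is that
   E lives one universe above the ordinals it codes.  The constructors of E,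
   the defining equations of Delta (which hold definitionally) and the
   induction principle are recovered below. *)
Inductive code : TOrd -> Type :=
| code_one : code oneT
| code_omega1 : code omega1T
| code_plus (t0 t1 : TOrd) : code t0 -> code t1 -> code (plusT t0 t1)
| code_times (t0 t1 : TOrd) : code t0 -> code t1 -> code (timesT t0 t1)
| code_sigma (t : TOrd) (u : t -> TOrd) :
    code t -> (forall x, code (u x)) -> code (sigmaT u).

Record E : Type := mkE { Delta : TOrd; code_of : code Delta }.

Definition E_one : E := mkE code_one.
Definition E_omega1 : E := mkE code_omega1.
Definition E_plus (n0 n1 : E) : E := mkE (code_plus (code_of n0) (code_of n1)).
Definition E_times (n0 n1 : E) : E := mkE (code_times (code_of n0) (code_of n1)).
Definition E_sigma (n : E) (A : Delta n -> E) : E :=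
  mkE (code_sigma (u := fun x => Delta (A x)) (code_of n) (fun x => code_of (A x))).

Fact Delta_one : Delta E_one = oneT.
Proof. reflexivity. Qed.
Fact Delta_omega1 : Delta E_omega1 = omega1T.
Proof. reflexivity. Qed.
Fact Delta_plus n0 n1 : Delta (E_plus n0 n1) = plusT (Delta n0) (Delta n1).
Proof. reflexivity. Qed.
Fact Delta_times n0 n1 :
  Delta (E_times n0 n1) = sigmaT (fun _ : Delta n0 => Delta n1).
Proof. reflexivity. Qed.
Fact Delta_sigma (n : E) (A : Delta n -> E) :
  Delta (E_sigma A) = sigmaT (fun x => Delta (A x)).
Proof. reflexivity. Qed.

Definition E_induction (P : E -> Type)
  (h_one : P E_one) (h_omega1 : P E_omega1)
  (h_plus : forall n0 n1, P n0 -> P n1 -> P (E_plus n0 n1))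
  (h_times : forall n0 n1, P n0 -> P n1 -> P (E_times n0 n1))
  (h_sigma : forall (n : E) (A : Delta n -> E),
      P n -> (forall x, P (A x)) -> P (E_sigma A))
  (n : E) : P n :=
  (fix go (t : TOrd) (c : code t) : P (mkE c) :=
     match c with
     | code_one => h_one
     | code_omega1 => h_omega1
     | code_plus c0 c1 => h_plus (mkE c0) (mkE c1) (go _ c0) (go _ c1)
     | code_times c0 c1 => h_times (mkE c0) (mkE c1) (go _ c0) (go _ c1)
     | code_sigma c0 d =>
         h_sigma (mkE c0) (fun x => mkE (d x)) (go _ c0) (fun x => go _ (d x))
     end) (Delta n) (code_of n).

Record completion (t : TOrd) : Type := mkCompletion {
  cK : TOrd;
  ciota : t -> cK;
  ciota_embedding : is_embedding ciota }.

Lemma id_embedding : is_embedding (fun x : oneT => x).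
Proof. apply (injective_embedding (@carrier_hset oneT)). trivial. Qed.

Definition plus_iota (t0 t1 k0 k1 : TOrd) (i0 : t0 -> k0) (i1 : t1 -> k1)
  (z : plusT t0 t1) : plusT k0 k1 :=
  match z with
  | existT _ (inl s) y => existT (fun b => pair_family k0 k1 b) (inl s) (i0 y)
  | existT _ (inr s) y => existT (fun b => pair_family k0 k1 b) (inr s) (i1 y)
  end.

Lemma plus_iota_embedding (t0 t1 k0 k1 : TOrd) (i0 : t0 -> k0) (i1 : t1 -> k1) :
  is_embedding i0 -> is_embedding i1 -> is_embedding (plus_iota i0 i1).
Proof.
  intros h0 h1. apply (injective_embedding (@carrier_hset (plusT k0 k1))).
  intros [[[]|[]] x] [[[]|[]] y] e; cbn in e.
  - apply (existT_inj2 (@carrier_hset twoT)) in e.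
    rewrite (embedding_injective h0 e). reflexivity.
  - apply (f_equal (@projT1 _ _)) in e. discriminate.
  - apply (f_equal (@projT1 _ _)) in e. discriminate.
  - apply (existT_inj2 (@carrier_hset twoT)) in e.
    rewrite (embedding_injective h1 e). reflexivity.
Qed.

Definition times_iota (t0 t1 k0 k1 : TOrd) (i0 : t0 -> k0) (i1 : t1 -> k1)
  (z : timesT t0 t1) : timesT k0 k1 :=
  existT (fun _ : k0 => k1) (i0 (projT1 z)) (i1 (projT2 z)).

Lemma times_iota_embedding (t0 t1 k0 k1 : TOrd) (i0 : t0 -> k0) (i1 : t1 -> k1) :
  is_embedding i0 -> is_embedding i1 -> is_embedding (times_iota i0 i1).
Proof.
  intros h0 h1. apply (injective_embedding (@carrier_hset (timesT k0 k1))).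
  intros [x a] [y b] e. unfold times_iota in e; cbn in e.
  assert (exy : x = y).
  { apply (embedding_injective h0). exact (f_equal (@projT1 _ _) e). }
  destruct exy. apply (existT_inj2 (@carrier_hset k0)) in e.
  rewrite (embedding_injective h1 e). reflexivity.
Qed.

Section SigmaIota.
Variables (t k : TOrd) (i : t -> k) (hi : is_embedding i).
Variables (u v : t -> TOrd) (f : forall x, u x -> v x).

Definition sigma_iota (z : sigmaT u) : sigmaT (extT hi v) :=
  existT (fun y => extT hi v y) (i (projT1 z)) (ext_eval_inv hi (f (projT2 z))).

Lemma sigma_iota_embedding :
  (forall x, is_embedding (@f x)) -> is_embedding sigma_iota.
Proof.
  intros hf. apply (injective_embedding (@carrier_hset (sigmaT (extT hi v)))).
  intros [x a] [y b] e. unfold sigma_iota in e; cbn in e.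
  assert (exy : x = y).
  { apply (embedding_injective hi). exact (f_equal (@projT1 _ _) e). }
  destruct exy. apply (existT_inj2 (@carrier_hset k)) in e.
  apply (f_equal (fun w => ext_eval (w : extT hi v (i x)))) in e.
  rewrite !ext_eval_section in e.
  rewrite (embedding_injective (hf x) e). reflexivity.
Qed.

End SigmaIota.

Arguments sigma_iota_embedding {t k i} hi {u v f} hf.

Fixpoint complete (t : TOrd) (c : code t) : completion t :=
  match c in code t return completion t with
  | code_one => mkCompletion id_embedding
  | code_omega1 => @mkCompletion omega1T conatT iota1 iota1_embedding
  | code_plus c0 c1 =>
      let k0 := complete c0 in
      let k1 := complete c1 in
      @mkCompletion _ (plusT (cK k0) (cK k1))
        (plus_iota (@ciota _ k0) (@ciota _ k1))
        (plus_iota_embedding (@ciota_embedding _ k0) (@ciota_embedding _ k1))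
  | code_times c0 c1 =>
      let k0 := complete c0 in
      let k1 := complete c1 in
      @mkCompletion _ (timesT (cK k0) (cK k1))
        (times_iota (@ciota _ k0) (@ciota _ k1))
        (times_iota_embedding (@ciota_embedding _ k0) (@ciota_embedding _ k1))
  | code_sigma c0 d =>
      let k0 := complete c0 in
      let k1 := fun x => complete (d x) in
      @mkCompletion _
        (sigmaT (extT (@ciota_embedding _ k0) (fun x => cK (k1 x))))
        (sigma_iota (@ciota_embedding _ k0) (fun x => @ciota _ (k1 x)))
        (sigma_iota_embedding (@ciota_embedding _ k0)
           (fun x => @ciota_embedding _ (k1 x)))
  end.

Definition K (n : E) : TOrd := cK (complete (code_of n)).

Definition iota (n : E) : Delta n -> K n := @ciota _ (complete (code_of n)).

Definition iota_embedding (n : E) : is_embedding (@iota n) :=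
  @ciota_embedding _ (complete (code_of n)).

Fact K_one : K E_one = oneT.
Proof. reflexivity. Qed.
Fact K_omega1 : K E_omega1 = conatT.
Proof. reflexivity. Qed.
Fact K_plus n0 n1 : K (E_plus n0 n1) = plusT (K n0) (K n1).
Proof. reflexivity. Qed.
Fact K_times n0 n1 : K (E_times n0 n1) = sigmaT (fun _ : K n0 => K n1).
Proof. reflexivity. Qed.
Fact K_sigma (n : E) (A : Delta n -> E) :
  K (E_sigma A) = sigmaT (extT (@iota_embedding n) (fun x => K (A x))).
Proof. reflexivity. Qed.

Fact iota_one (x : Delta E_one) : iota x = (x : K E_one).
Proof. reflexivity. Qed.
Fact iota_omega1 (x : Delta E_omega1) : iota x = (iota1 x : K E_omega1).
Proof. reflexivity. Qed.
Fact iota_plus_inl n0 n1 (y : Delta n0) :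
  iota (existT _ (inl tt) y : Delta (E_plus n0 n1)) =
  (existT (fun b => pair_family (K n0) (K n1) b) (inl tt) (iota y)
    : K (E_plus n0 n1)).
Proof. reflexivity. Qed.
Fact iota_plus_inr n0 n1 (y : Delta n1) :
  iota (existT _ (inr tt) y : Delta (E_plus n0 n1)) =
  (existT (fun b => pair_family (K n0) (K n1) b) (inr tt) (iota y)
    : K (E_plus n0 n1)).
Proof. reflexivity. Qed.
Fact iota_times n0 n1 (x : Delta n0) (y : Delta n1) :
  iota (existT _ x y : Delta (E_times n0 n1)) =
  (existT (fun _ => carrier (K n1)) (iota x) (iota y) : K (E_times n0 n1)).
Proof. reflexivity. Qed.
Fact iota_sigma (n : E) (A : Delta n -> E) (x : Delta n) (z : Delta (A x)) :
  iota (existT _ x z : Delta (E_sigma A)) =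
  (existT (fun k => extT (@iota_embedding n) (fun x => K (A x)) k) (iota x)
     (ext_eval_inv (a := fun x => K (A x)) (@iota_embedding n) (iota z))
    : K (E_sigma A)).
Proof. reflexivity. Qed.

(* Main.v *)
Require Import Defs.
From Stdlib Require Import Bool FunctionalExtensionality.

(** The family over omega + 1 with members [1] at every finite point and
    [1 + 1] at the top is coded, and its completed sum consists of the
    conaturals with the point infinity doubled: over [u] lies the product of
    the members indexed by the fiber of the embedding of omega + 1, and a point
    of this product is a choice of side for each proof that [u] is infinite.

    The two constant choices give two sections over the conaturals, which agree
    wherever [u] differs from infinity, because there the choice is vacuous.  A
    boolean map [p] that separates the two points at infinity would therefore
    decide whether an arbitrary conatural [u] is infinite, by comparing the
    values of [p] on the two sections at [u] ([WLPO_of_separation]).  Hence, if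
    WLPO fails, no [p] separates these two points; total separatedness then
    identifies them, which contradicts that the two sides differ
    ([point_at_infinity_inj]). *)

(** The conatural whose [n]-th digit tests the conjunction of [p 0, ..., p n];
    it is infinite exactly when [p] is constantly true. *)
Fixpoint all_upto (p : nat -> bool) (n : nat) : bool :=
  match n with
  | 0 => p 0
  | S m => p (S m) && all_upto p m
  end.

Lemma all_upto_decreasing (p : nat -> bool) (i : nat) :
  Bool.le (all_upto p (S i)) (all_upto p i).
Proof. cbn. destruct (p (S i)), (all_upto p i); cbn; trivial. Qed.

Definition prefix_conat (p : nat -> bool) : conat :=
  existT (fun u => forall i, Bool.le (u (S i)) (u i))
    (all_upto p) (all_upto_decreasing p).

Lemma prefix_conat_infty (p : nat -> bool) :
  (forall n, p n = true) -> prefix_conat p = infty.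
Proof.
  intros h. apply conat_ext. intros n. cbn.
  induction n as [|n IH]; cbn; [apply h|]. rewrite h, IH. reflexivity.
Qed.

Lemma prefix_conat_infty_inv (p : nat -> bool) :
  prefix_conat p = infty -> forall n, p n = true.
Proof.
  intros e n. pose proof (f_equal (fun w => conat_at w n) e) as h.
  cbn in h. destruct n; cbn in h; [exact h|].
  exact (proj1 (andb_prop _ _ h)).
Qed.

(** Comparing [f] with [g] at [u] decides whether [u] is infinite: agreement
    excludes [u = infty], and disagreement excludes [u <> infty]. *)
Lemma WLPO_of_separation (f g : conat -> bool) :
  (forall u, u <> infty -> f u = g u) -> f infty <> g infty -> WLPO.
Proof.
  intros agree differ p.
  destruct (bool_dec (f (prefix_conat p)) (g (prefix_conat p))) as [e|ne].
  - right. intros h. rewrite (prefix_conat_infty p h) in e. exact (differ e).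
  - left. intros n. destruct (p n) eqn:pn; [reflexivity|].
    destruct ne. apply agree. intros e.
    rewrite (prefix_conat_infty_inv p e n) in pn. discriminate.
Qed.

Definition doubled_top_family (x : Delta E_omega1) : E :=
  match (x : nat + unit) with
  | inl _ => E_one
  | inr _ => E_plus E_one E_one
  end.

Definition E_doubled_top : E := E_sigma (n := E_omega1) doubled_top_family.

(** The match is on the point of omega + 1 in the fiber over [u], so the choice
    exists for every [u] although it is undecided whether [u] is infinite. *)
Definition side_choice (b : K (E_plus E_one E_one)) (u : conat) :
  extT (@iota_embedding E_omega1) (fun x => K (doubled_top_family x)) u :=
  fun q => match projT1 q as x return K (doubled_top_family x) with
           | inl _ => tt
           | inr _ => b
           end.

Definition side_section (b : K (E_plus E_one E_one)) (u : conat) :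
  K E_doubled_top :=
  existT (fun k => extT (@iota_embedding E_omega1)
                     (fun x => K (doubled_top_family x)) k)
    u (side_choice b u).

Lemma side_section_finite (b c : K (E_plus E_one E_one)) (u : conat) :
  u <> infty -> side_section b u = side_section c u.
Proof.
  intros ne. unfold side_section. f_equal.
  apply functional_extensionality_dep. intros [[n|[]] e].
  - reflexivity.
  - destruct (ne (eq_sym e)).
Qed.

(** Equal pairs have equal second components because the conaturals form a
    set; evaluation at the top of omega + 1 recovers the side. *)
Lemma point_at_infinity_inj (b c : K (E_plus E_one E_one)) :
  side_section b infty = side_section c infty -> b = c.
Proof.
  intros e. apply (existT_inj2 conat_hset) in e.
  exact (f_equal (fun w => w (existT _ (inr tt) eq_refl)) e).
Qed.

Theorem proposition7p12 :
  (forall n : E, ord_totally_separated (K n)) -> neg (neg WLPO).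
Proof.
  intros ts nwlpo.
  pose (b := existT (fun b => pair_family oneT oneT b) (inl tt) tt
             : K (E_plus E_one E_one)).
  pose (c := existT (fun b => pair_family oneT oneT b) (inr tt) tt
             : K (E_plus E_one E_one)).
  assert (e : b = c).
  { apply point_at_infinity_inj. apply (ts E_doubled_top). intros p.
    destruct (bool_dec (p (side_section b infty)) (p (side_section c infty)))
      as [same|differ]; [exact same|].
    destruct nwlpo.
    apply (WLPO_of_separation (fun u => p (side_section b u))
                              (fun u => p (side_section c u))); [|exact differ].
    intros u ne. f_equal. exact (side_section_finite b c u ne). }
  apply (f_equal (@projT1 _ _)) in e. discriminate e.
Qed.
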